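(* Let $\mathfrak{X}$ be a face-edge-constraint net, let $\phi:F\to\mathbb{H}\setminus\{0\}$ be a spinor, and suppose the spin transformation $s_\phi$ maps $\mathfrak{X}$ to the face-edge-constraint net $\mathfrak{X}'$ (on the same cell complex $X$), i.e. the hyperedges and normals of $\mathfrak{X}'$ are $E'_{ij}=\overline{\phi_i}\cdot E_{ij}\cdot\phi_j$ and $n_i'=\phi_i^{-1}\cdot n_i\cdot\phi_i$. Then for every loop $\gamma_i$ at a face $\Delta_i$, $$\mathrm{cr}_{\mathfrak{X}'}(\gamma_i)=\begin{cases}\phi_i^{-1}\cdot\mathrm{cr}_{\mathfrak{X}}(\gamma_i)\cdot\phi_i & |\gamma_i|\text{ even},\\ \phi_i^{-1}\cdot\mathrm{cr}_{\mathfrak{X}}(\gamma_i)\cdot\overline{\phi_i}^{\,-1}&|\gamma_i|\text{ odd}.\end{cases}$$ Therefore the argument and the norm of the spin multi-ratio are preserved if the length of the loop is even.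
   Context: $\mathbb{R}^3$ is identified with $\mathrm{Im}(\mathbb{H})$. Oriented net: $X=(V,E,F)$ is a connected cell complex decomposing an oriented surface into polygonal faces; two adjacent faces share exactly one edge, and every edge is shared by exactly two faces. Edges of each face carry its boundary orientation. For $f:V\to\mathbb{R}^3$ and adjacent faces $\Delta_i,\Delta_j$, $df_{ij}\in\mathrm{Im}(\mathbb{H})$ is the edge vector of the common edge oriented as in $\Delta_i$ ($df_{ij}=-df_{ji}$). Face-edge-constraint net: $(X,f,n)$ with $n:F\to\mathbb{S}^2$ and $n_i+n_j\perp df_{ij}$ for all adjacent faces. It is assumed that $df_{ij}\ne0$, $n_i\nparallel df_{ij}$, and the dihedral angle $\theta_{ij}\in(-\pi,\pi)$, the angle of the right-handed rotation about $df_{ij}$ taking the half-plane $\mathbb{R}\,df_{ij}+\mathbb{R}_{>0}n_i$ to $\mathbb{R}\,df_{ij}+\mathbb{R}_{>0}n_j$. Hyperedge: $E_{ij}=|df_{ij}|\tan\tfrac{\theta_{ij}}2+df_{ij}\in\mathbb{H}$. A path is a sequence of faces $\gamma=(\gamma(1),\dots,\gamma(n))$ with consecutive faces adjacent; its length is $|\gamma|=n-1$. A loop at $\Delta_i$ is a path starting and ending at $\Delta_i$. The spin multi-ratio is $$\mathrm{cr}_{\mathfrak X}(\gamma)=\overline{E_{\gamma(1),\gamma(2)}}^{\,-1}\cdot E_{\gamma(2),\gamma(3)}\cdot\overline{E_{\gamma(3),\gamma(4)}}^{\,-1}\cdots,$$ the factors alternating between $\overline{E}^{\,-1}$ and $E$,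 so the last factor is $E_{\gamma(n-1),\gamma(n)}$ if $|\gamma|$ is even and $\overline{E_{\gamma(n-1),\gamma(n)}}^{\,-1}$ if $|\gamma|$ is odd. For an even loop at $\Delta_i$, the imaginary part of $\mathrm{cr}_{\mathfrak X}(\gamma)$ is a real multiple of $n_i$; its argument is the $\alpha\in\mathbb{R}/2\pi\mathbb{Z}$ with $\mathrm{cr}_{\mathfrak X}(\gamma)=|\mathrm{cr}_{\mathfrak X}(\gamma)|(\cos\alpha+\sin\alpha\, n_i)$ (and likewise for $\mathfrak{X}'$ with $n_i'$). *)

(* Defs.v *)
From HB Require Import structures.
From mathcomp Require Import all_boot all_order all_algebra.
From mathcomp Require Import ring lra.
From mathcomp Require Import all_classical all_reals all_analysis.

Set Implicit Arguments.
Unset Strict Implicit.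
Unset Printing Implicit Defensive.

Import Order.TTheory GRing.Theory Num.Theory.

Local Open Scope classical_set_scope.
Local Open Scope ring_scope.

(* [Quat a b c d] is a + b i + c j + d k. *)
Record quat (R : Type) := Quat { qre : R; qi : R; qj : R; qk : R }.

Definition quat_tuple (R : Type) (x : quat R) := (qre x, qi x, qj x, qk x).
Definition tuple_quat (R : Type) (t : R * R * R * R) :=
  let: (a, b, c, d) := t in Quat a b c d.

Lemma quat_tupleK (R : Type) : cancel (@quat_tuple R) (@tuple_quat R).
Proof. by case. Qed.

HB.instance Definition _ (R : choiceType) :=
  Choice.copy (quat R) (can_type (@quat_tupleK R)).

Section QuatAlgebra.
Variable R : realFieldType.
Implicit Types (x y z : quat R) (s t : R).

Definition qadd x y :=
  Quat (qre x + qre y) (qi x + qi y) (qj x + qj y) (qk x + qk y).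
Definition qopp x := Quat (- qre x) (- qi x) (- qj x) (- qk x).
Definition qscale s x := Quat (s * qre x) (s * qi x) (s * qj x) (s * qk x).
Definition qmul x y :=
  Quat (qre x * qre y - qi x * qi y - qj x * qj y - qk x * qk y)
       (qre x * qi y + qi x * qre y + qj x * qk y - qk x * qj y)
       (qre x * qj y - qi x * qk y + qj x * qre y + qk x * qi y)
       (qre x * qk y + qi x * qj y - qj x * qi y + qk x * qre y).
Definition qconj x := Quat (qre x) (- qi x) (- qj x) (- qk x).
Definition qnorm2 x := qre x ^+ 2 + qi x ^+ 2 + qj x ^+ 2 + qk x ^+ 2.
(* Total inverse: it sends 0 to 0. *)
Definition qinv x := qscale (qnorm2 x)^-1 (qconj x).

Let quat_ext x y : qre x = qre y -> qi x = qi y -> qj x = qj y ->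
  qk x = qk y -> x = y.
Proof. by case: x y => [a b c d] [a' b' c' d'] /= -> -> -> ->. Qed.

Let qaddA : associative qadd.
Proof. by move=> x y z; apply: quat_ext => /=; ring. Qed.
Let qaddC : commutative qadd.
Proof. by move=> x y; apply: quat_ext => /=; ring. Qed.
Let qadd0 : left_id (Quat 0 0 0 0) qadd.
Proof. by move=> x; apply: quat_ext => /=; ring. Qed.
Let qaddN : left_inverse (Quat 0 0 0 0) qopp qadd.
Proof. by move=> x; apply: quat_ext => /=; ring. Qed.

HB.instance Definition _ :=
  GRing.isZmodule.Build (quat R) qaddA qaddC qadd0 qaddN.

Let qmulA : associative qmul.
Proof. by move=> x y z; apply: quat_ext => /=; ring. Qed.
Let qmul1l : left_id (Quat 1 0 0 0) qmul.
Proof. by move=> x; apply: quat_ext => /=; ring. Qed.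
Let qmul1r : right_id (Quat 1 0 0 0) qmul.
Proof. by move=> x; apply: quat_ext => /=; ring. Qed.
Let qmulDl : left_distributive qmul +%R.
Proof. by move=> x y z; apply: quat_ext => /=; ring. Qed.
Let qmulDr : right_distributive qmul +%R.
Proof. by move=> x y z; apply: quat_ext => /=; ring. Qed.
Let quat1_neq0 : Quat 1 0 0 0 != 0 :> quat R.
Proof. by apply/eqP => -[] /eqP; rewrite oner_eq0. Qed.

HB.instance Definition _ := GRing.Zmodule_isNzRing.Build (quat R)
  qmulA qmul1l qmul1r qmulDl qmulDr quat1_neq0.

Let qscaleA s t x : qscale s (qscale t x) = qscale (s * t) x.
Proof. by apply: quat_ext => /=; ring. Qed.
Let qscale1 : left_id 1 qscale.
Proof. by move=> x; apply: quat_ext => /=; ring. Qed.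
Let qscaleDr : right_distributive qscale +%R.
Proof. by move=> s x y; apply: quat_ext => /=; ring. Qed.
Let qscaleDl x : {morph qscale^~ x : s t / s + t}.
Proof. by move=> s t; apply: quat_ext => /=; ring. Qed.

HB.instance Definition _ := GRing.Zmodule_isLmodule.Build R (quat R)
  qscaleA qscale1 qscaleDr qscaleDl.

Let qscaleAl s x y : s *: (x * y) = s *: x * y.
Proof. by apply: quat_ext => /=; ring. Qed.

HB.instance Definition _ := GRing.Lmodule_isLalgebra.Build R (quat R) qscaleAl.

Let qscaleAr s x y : s *: (x * y) = x * (s *: y).
Proof. by apply: quat_ext => /=; ring. Qed.

HB.instance Definition _ := GRing.Lalgebra_isAlgebra.Build R (quat R) qscaleAr.

Lemma qnorm2_eq0 x : (qnorm2 x == 0) = (x == 0).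
Proof.
rewrite /qnorm2 !paddr_eq0 ?addr_ge0 ?sqr_ge0 // !sqrf_eq0.
apply/idP/eqP => [|-> /=]; last by rewrite eqxx.
by case: x => a b c d /= /andP[/andP[/andP[/eqP-> /eqP->] /eqP->] /eqP->].
Qed.

Let qmulV : {in [pred x | x != 0], left_inverse 1 qinv *%R}.
Proof.
move=> x; rewrite inE -qnorm2_eq0 => x0.
by apply: quat_ext => /=; rewrite /qnorm2 in x0 *; field.
Qed.
Let qmulrV : {in [pred x | x != 0], right_inverse 1 qinv *%R}.
Proof.
move=> x; rewrite inE -qnorm2_eq0 => x0.
by apply: quat_ext => /=; rewrite /qnorm2 in x0 *; field.
Qed.
Let qunitP x y : y * x = 1 /\ x * y = 1 -> x != 0.
Proof.
by case=> + _; apply: contra_eq_neq => ->; rewrite mulr0 eq_sym oner_neq0.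
Qed.
Let qinv0 : {in [predC [pred x | x != 0]], qinv =1 id}.
Proof. by move=> x; rewrite !inE negbK => /eqP->; apply: quat_ext => /=; ring. Qed.

HB.instance Definition _ :=
  GRing.NzRing_hasMulInverse.Build (quat R) qmulV qmulrV qunitP qinv0.

(* The identification of R^3 with Im(H). *)
Definition imaginary x := qre x = 0.
Definition qdot x y := qi x * qi y + qj x * qj y + qk x * qk y.
Definition parallel x y :=
  exists s t, (s, t) != (0, 0) /\ s *: x + t *: y = 0.

End QuatAlgebra.

Definition qnorm (R : rcfType) (x : quat R) : R := Num.sqrt (qnorm2 x).

Section Rotation.
Variable R : realType.
Implicit Types (u a v : quat R) (theta : R).

(* The rotation of Im(H) by [theta] about the nonzero axis [u]; it is
   right-handed for the oriented basis (i, j, k). *)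
Definition rotation u theta v :=
  let q := (cos (theta / 2))%:A + (sin (theta / 2) / qnorm u) *: u in
  q * v * q^-1.

Definition half_plane u a : set (quat R) :=
  [set v | exists s t : R, 0 < t /\ v = s *: u + t *: a].

Definition is_dihedral_angle u a b theta :=
  - pi < theta < pi /\ rotation u theta @` half_plane u a = half_plane u b.

Definition dihedral_angle u a b : R := xget 0 (is_dihedral_angle u a b).

End Rotation.

(* A cell decomposition of an oriented surface is encoded by its darts
   (oriented edges). The two orientations of an edge are [d] and [dart_rev d], so
   that the edges are the pairs {d, dart_rev d}. Each dart lies in the oriented
   boundary of exactly one face [lface d], in which it is followed by [dart_next d];
   [orig d] is its first vertex. Turning around [orig d] sends [d] to
   [dart_next (dart_rev d)]. Since [lface (dart_next d) = lface d] (and likewise for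
   vertices), [lface_orbit] and [orig_orbit] force the orbits to be finite
   cycles: faces are polygons, and the darts at a vertex form one finite cycle,
   so that the space is a surface there. Finiteness of the complex is not
   required. *)
Record oriented_net := OrientedNet {
  vertex : Type;
  dart : Type;
  face : Type;
  orig : dart -> vertex;
  lface : dart -> face;
  dart_rev : dart -> dart;
  dart_next : dart -> dart;
  dart_revK : involutive dart_rev;
  lface_orbit : forall d d',
    lface d = lface d' <-> exists k, iter k dart_next d = d';
  orig_orbit : forall d d',
    orig d = orig d' <-> exists k, iter k (dart_next \o dart_rev) d = d';
  lface_surj : forall i, exists d, lface d = i;
  orig_surj : forall v, exists d, orig d = v;
  net_connected : forall P : set dart, P !=set0 ->
    (forall d, P d -> P (dart_rev d)) -> (forall d, P d -> P (dart_next d)) ->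
    forall d, P d;
  lface_dart_rev : forall d, lface (dart_rev d) <> lface d;
  one_common_edge : forall d d', lface d = lface d' ->
    lface (dart_rev d) = lface (dart_rev d') -> d = d'
}.

Section Net.
Variable X : oriented_net.
Implicit Types (i j : face X) (p : seq (face X)).

(* [d] is the common edge of the faces i and j, oriented as in i. *)
Definition common_edge i j (d : dart X) := lface d = i /\ lface (dart_rev d) = j.

Definition adjacent_faces i j : Prop := exists d, common_edge i j d.

(* The path (i, p_1, ..., p_m) of length m is given by its first face and the
   sequence p of the others. *)
Definition is_path i p : bool := path (fun j k => `[< adjacent_faces j k >]) i p.

Definition is_loop i p : Prop := is_path i p /\ last i p = i.

End Net.

Section EdgeVector.
Variables (R : realType) (X : oriented_net) (f : vertex X -> quat R).

(* By [one_common_edge] there is at most one choice of [d]; the value at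
   non-adjacent faces is a dummy. *)
Definition edge_vector (i j : face X) : quat R :=
  if pselect (adjacent_faces i j) is left ij then
    let d := projT1 (cid ij) in f (orig (dart_rev d)) - f (orig d)
  else 0.

End EdgeVector.

Record face_edge_net (R : realType) (X : oriented_net) := FaceEdgeNet {
  vertex_pos : vertex X -> quat R;
  face_normal : face X -> quat R;
  pos_im : forall v, imaginary (vertex_pos v);
  normal_im : forall i, imaginary (face_normal i);
  normal_unit : forall i, qnorm (face_normal i) = 1;
  face_edge_constraint : forall i j, adjacent_faces i j ->
    qdot (face_normal i + face_normal j) (edge_vector vertex_pos i j) = 0;
  edge_vector_neq0 : forall i j, adjacent_faces i j -> edge_vector vertex_pos i j != 0;
  normal_nparallel : forall i j, adjacent_faces i j ->
    ~ parallel (face_normal i) (edge_vector vertex_pos i j);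
  has_dihedral_angle : forall i j, adjacent_faces i j -> exists theta,
    is_dihedral_angle (edge_vector vertex_pos i j) (face_normal i) (face_normal j) theta
}.

Section SpinMultiRatio.
Variables (R : realType) (X : oriented_net) (N : face_edge_net R X).
Implicit Types (i j : face X) (p : seq (face X)).

Definition hyperedge i j : quat R :=
  let df := edge_vector (vertex_pos N) i j in
  (qnorm df * tan (dihedral_angle df (face_normal N i) (face_normal N j) / 2))%:A + df.

(* Steps are numbered from 0, so that the first factor is a conjugate inverse;
   the trivial path has multi-ratio 1. *)
Definition spin_multi_ratio i p : quat R :=
  \prod_(k < size p)
    let E := hyperedge (nth i (i :: p) k) (nth i p k) in
    if odd k then E else (qconj E)^-1.

(* For an even loop at i this is a (nonempty) coset of 2 pi Z, i.e. an element
   of R / 2 pi Z. *)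
Definition spin_argument i p : set R :=
  let c := spin_multi_ratio i p in
  [set alpha | c = qnorm c *: ((cos alpha)%:A + sin alpha *: face_normal N i)].

End SpinMultiRatio.

Definition spin_transformation (R : realType) (X : oriented_net)
    (phi : face X -> quat R) (N N' : face_edge_net R X) : Prop :=
  (forall i j, adjacent_faces i j ->
     hyperedge N' i j = qconj (phi i) * hyperedge N i j * phi j) /\
  (forall i, face_normal N' i = (phi i)^-1 * face_normal N i * phi i).

(* Main.v *)
Require Import Defs.
From mathcomp Require Import all_boot all_order all_algebra.
From mathcomp Require Import all_classical all_reals all_analysis.
From mathcomp Require Import ring.

Import GRing.Theory.

Local Open Scope ring_scope.

(** Along the faces [v_0, v_1, ...] of a path, the spin transformation acts on
   the k-th factor of the multi-ratio as a change of gauge: with [g_k = phi v_k]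
   for even k and [g_k = (qconj (phi v_k))^-1] for odd k, both kinds of factors
   satisfy the same rule [F'_k = g_k^-1 * F_k * g_(k+1)]. Indeed, for odd k this
   is [E' = qconj phi_k * E * phi_(k+1)] itself, and for even k it is what
   conjugating and inverting this equation gives, as both operations reverse
   products ([qconjM], [qinvM]). Hence the product telescopes to
   [g_0^-1 * (prod F) * g_n] ([prod_gauge]). On a loop [v_n = v_0], and the
   parity of n decides which of the two forms [g_n] has.

   For even n this is conjugation by [phi i], which also carries the normal
   [n_i] to [n_i']. Conjugation is an R-linear, norm-preserving bijection, so it
   preserves the polar equation that defines the argument. *)

Section Quaternions.
Variable R : realFieldType.
Implicit Types x y : quat R.

Lemma quat_eq x y : qre x = qre y -> qi x = qi y -> qj x = qj y ->
  qk x = qk y -> x = y.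
Proof. by case: x y => [a b c d] [a' b' c' d'] /= -> -> -> ->. Qed.

Lemma qunitE x : (x \is a GRing.unit) = (x != 0).
Proof. by []. Qed.

Lemma qconjM x y : qconj (x * y) = qconj y * qconj x.
Proof. by apply: quat_eq => /=; ring. Qed.

Lemma qconjK : involutive (@qconj R).
Proof. by case=> a b c d; apply: quat_eq => /=; ring. Qed.

Lemma qconj_eq0 x : (qconj x == 0) = (x == 0).
Proof. by rewrite -!qnorm2_eq0 /qnorm2 /= !sqrrN. Qed.

Lemma qnorm2M x y : qnorm2 (x * y) = qnorm2 x * qnorm2 y.
Proof. by rewrite /qnorm2 /=; ring. Qed.

(** When a factor is 0 this rests on the convention [0^-1 = 0], which makes the
   rule available for all factors of a multi-ratio. *)
Lemma qinvM x y : (x * y)^-1 = y^-1 * x^-1.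
Proof.
have [->|x0] := eqVneq x 0; first by rewrite mul0r invr0 mulr0.
have [->|y0] := eqVneq y 0; first by rewrite mulr0 invr0 mul0r.
by rewrite invrM ?qunitE.
Qed.

Lemma qnorm2J (x y : quat R) : y != 0 -> qnorm2 (y^-1 * x * y) = qnorm2 x.
Proof.
move=> y0; rewrite !qnorm2M mulrAC -qnorm2M mulVr ?qunitE //.
by rewrite /qnorm2 /=; ring.
Qed.

End Quaternions.

(** The product telescopes: [g k.+1] at the end of one factor cancels against
   its inverse at the beginning of the next. *)
Lemma prod_gauge (S : unitRingType) (g F F' : nat -> S) (n : nat) :
    (forall k, g k \is a GRing.unit) ->
    (forall k, (k < n)%N -> F' k = (g k)^-1 * F k * g k.+1) ->
  \prod_(k < n) F' k = (g 0%N)^-1 * (\prod_(k < n) F k) * g n.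
Proof.
move=> gU; elim: n => [_|n IHn F'E]; first by rewrite !big_ord0 mulr1 mulVr.
rewrite !big_ord_recr /= IHn; last by move=> k kn; apply: F'E; apply: ltnW.
by rewrite F'E // !mulrA mulrK.
Qed.

(** Conjugation is linear and fixes the scalars, so it acts on a polar form
   through the direction [n] alone. *)
Lemma polar_conjugate (K : nzRingType) (A : unitAlgType K) (x n : A)
    (r a b : K) : x \is a GRing.unit ->
  r *: (a%:A + b *: (x^-1 * n * x)) = x^-1 * (r *: (a%:A + b *: n)) * x.
Proof.
move=> xU; rewrite -[in RHS]scalerAr -[in RHS]scalerAl; congr (r *: _).
by rewrite [in RHS]mulrDr [in RHS]mulrDl -!scalerAr -!scalerAl mulr1 mulVr.
Qed.

(** A path that need not close up: at its end, the parity of the length selects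
   which of the two gauges remains. *)
Lemma spin_multi_ratio_path (R : realType) (X : oriented_net)
    (N N' : face_edge_net R X) (phi : face X -> quat R) (i : face X)
    (p : seq (face X)) :
    (forall j, phi j != 0) -> spin_transformation phi N N' -> is_path i p ->
  spin_multi_ratio N' i p = (phi i)^-1 * spin_multi_ratio N i p *
    (if odd (size p) then (qconj (phi (last i p)))^-1 else phi (last i p)).
Proof.
move=> phi0 [E'E _] /(pathP i) adj; rewrite (last_nth i).
pose v k := nth i (i :: p) k.
pose g k := if odd k then (qconj (phi (v k)))^-1 else phi (v k).
pose F (M : face_edge_net R X) k :=
  let E := hyperedge M (v k) (nth i p k) in if odd k then E else (qconj E)^-1.
apply: (@prod_gauge _ g (F N) (F N')) => k.
  by rewrite /g; case: odd; rewrite ?unitrV qunitE ?qconj_eq0.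
move=> /adj /asboolP vk; rewrite /F /= E'E // /g /=.
by case: odd; rewrite /= ?invrK // !qconjM !qinvM qconjK.
Qed.

Theorem proposition3p25 (R : realType) (X : oriented_net)
    (N N' : face_edge_net R X) (phi : face X -> quat R)
    (phi_neq0 : forall i, phi i != 0)
    (phiN : spin_transformation phi N N')
    (i : face X) (gamma : seq (face X)) (loop_gamma : is_loop i gamma) :
  spin_multi_ratio N' i gamma =
    (if odd (size gamma)
     then (phi i)^-1 * spin_multi_ratio N i gamma * (qconj (phi i))^-1
     else (phi i)^-1 * spin_multi_ratio N i gamma * phi i) /\
  (~~ odd (size gamma) ->
     spin_argument N' i gamma = spin_argument N i gamma /\
     qnorm (spin_multi_ratio N' i gamma) = qnorm (spin_multi_ratio N i gamma)).
Proof.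
have [path_gamma last_gamma] := loop_gamma.
have := @spin_multi_ratio_path _ _ _ _ _ _ _ phi_neq0 phiN path_gamma.
rewrite last_gamma => crE; split; first by rewrite crE; case: odd.
move=> /negbTE even_gamma; rewrite even_gamma in crE.
have normE : qnorm (spin_multi_ratio N' i gamma) =
             qnorm (spin_multi_ratio N i gamma) by rewrite crE /qnorm qnorm2J.
split=> //; apply/seteqP.
have phiU : phi i \is a GRing.unit by rewrite qunitE.
have phiVU : (phi i)^-1 \is a GRing.unit by rewrite unitrV.
split=> alpha; rewrite /spin_argument /= normE phiN.2 polar_conjugate // crE;
  last by move=> <-.
by move=> /(mulIr phiU) /(mulrI phiVU).
Qed.
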